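(* Assume that $\operatorname{cov}(\mathcal{M})=\operatorname{cof}(\mathcal{M})$ and that the cardinal number $\operatorname{cov}(\mathcal{M})$ is regular. Then for every $\operatorname{cov}(\mathcal{M})$-Luzin group $X\subseteq P(\mathbb{N})$ there is a $\operatorname{cov}(\mathcal{M})$-Luzin group $Y\subseteq P(\mathbb{N})$ such that the product space $X\times Y$ is not Menger.
   Context: The power set $P(\mathbb{N})$ is identified with the Cantor cube $\{0,1\}^{\mathbb{N}}$ via characteristic functions and carries its topology; with the symmetric difference operation $a\oplus b=(a\cup b)\setminus(a\cap b)$ it is a topological group. $\operatorname{cov}(\mathcal{M})$ is the minimal cardinality of a family of meager subsets of $\mathbb{R}$ that covers $\mathbb{R}$; $\operatorname{cof}(\mathcal{M})$ is the minimal cardinality of a family of meager subsets of $\mathbb{R}$ such that every meager subset of $\mathbb{R}$ is contained in a member of the family (replacing $\mathbb{R}$ by $P(\mathbb{N})$ gives the same cardinals). A set $X\subseteq P(\mathbb{N})$ is a $\operatorname{cov}(\mathcal{M})$-Luzin set if $|X|\ge\operatorname{cov}(\mathcal{M})$ and $|X\cap M|<\operatorname{cov}(\mathcal{M})$ for every meager set $M\subseteq P(\mathbb{N})$. A $\operatorname{cov}(\mathcal{M})$-Luzin group $X\subseteq P(\mathbb{N})$ is a $\operatorname{cov}(\mathcal{M})$-Luzin set that is a topological group with the operation $\oplus$, i.e., a subgroup of $(P(\mathbb{N}),\oplus)$. A space $X$ is Menger if for every sequence $\mathcal{U}_1,\mathcal{U}_2,\dots$ of open covers of $X$ there are finite $\mathcal{F}_1\subseteq\mathcal{U}_1,\mathcal{F}_2\subseteq\mathcal{U}_2,\dots$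 such that $\bigcup_n\mathcal{F}_n$ covers $X$. *)

(* Defs.v *)
From HB Require Import structures.
From mathcomp Require Import all_boot all_order all_algebra.
From mathcomp Require Import all_classical all_reals all_analysis.
Import numFieldNormedType.Exports.

Set Implicit Arguments.
Unset Strict Implicit.
Unset Printing Implicit Defensive.

Local Open Scope classical_set_scope.
Local Open Scope card_scope.

Definition nowhere_dense (T : topologicalType) (A : set T) : Prop :=
  interior (closure A) = set0.

Definition meager (T : topologicalType) (A : set T) : Prop :=
  exists F : nat -> set T,
    (forall n, nowhere_dense (F n)) /\ A = \bigcup_n F n.

(* Cardinal numbers are represented by sets, up to the equipotence [#=]. *)

Definition card_lt (T U : Type) (A : set T) (B : set U) : Prop :=
  A #<= B /\ ~ (B #<= A).

(* |K| is the minimum of |F| over the families F satisfying P. *)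
Definition is_min_card (V : Type) (P : set (set V)) (T : Type) (K : set T) :
    Prop :=
  (exists F : set V, P F /\ F #= K) /\ (forall F : set V, P F -> K #<= F).

Definition meager_cover (T : topologicalType) (F : set (set T)) : Prop :=
  F `<=` @meager T /\ \bigcup_(M in F) M = [set: T].

Definition meager_cofinal (T : topologicalType) (F : set (set T)) : Prop :=
  F `<=` @meager T /\
  (forall A : set T, meager A -> exists M : set T, F M /\ A `<=` M).

(* |K| = cov(M) and |K| = cof(M), computed on the real line. *)
Definition is_covM (R : realType) (T : Type) (K : set T) : Prop :=
  is_min_card (@meager_cover R) K.

Definition is_cofM (R : realType) (T : Type) (K : set T) : Prop :=
  is_min_card (@meager_cofinal R) K.

(* |K| is infinite and K is not the union of fewer than |K| sets each of
   cardinality less than |K|. *)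
Definition regular_card (T : Type) (K : set T) : Prop :=
  infinite_set K /\
  (forall F : set (set T),
     card_lt F K -> (forall A, F A -> card_lt A K) -> \bigcup_(A in F) A <> K).

(* Subsets of nat are points of [cantor_space] via characteristic functions. *)

Definition empty_pt : cantor_space := fun=> false.

Definition symdiff (a b : cantor_space) : cantor_space :=
  fun n => (a n || b n) && ~~ (a n && b n).

(* Closure under inverses is automatic: [symdiff a a] is [empty_pt]. *)
Definition symdiff_subgroup (X : set cantor_space) : Prop :=
  X empty_pt /\ (forall a b, X a -> X b -> X (symdiff a b)).

Definition luzin_set (T : Type) (K : set T) (X : set cantor_space) : Prop :=
  K #<= X /\
  (forall M : set cantor_space, meager M -> card_lt (X `&` M) K).

Definition luzin_group (T : Type) (K : set T) (X : set cantor_space) : Prop :=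
  luzin_set K X /\ symdiff_subgroup X.

Definition open_cover (T : topologicalType) (U : set (set T)) : Prop :=
  (forall V, U V -> open V) /\ \bigcup_(V in U) V = [set: T].

Definition menger (T : topologicalType) : Prop :=
  forall U : nat -> set (set T), (forall n, open_cover (U n)) ->
  exists F : nat -> set (set T),
    (forall n, finite_set (F n) /\ F n `<=` U n) /\
    \bigcup_n \bigcup_(V in F n) V = [set: T].

(* Main.v *)
Require Import Defs.
From mathcomp Require Import all_boot all_order all_algebra.
From mathcomp Require Import all_classical all_reals all_analysis.
From mathcomp Require Import wochoice lra zify.
Import Order.TTheory GRing.Theory Num.Theory.
Import numFieldNormedType.Exports.

Set Implicit Arguments.
Unset Strict Implicit.
Unset Printing Implicit Defensive.

Local Open Scope classical_set_scope.
Local Open Scope card_scope.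

(** Binary expansions carry a cofinal family of meager sets of the line to a
    cofinal family [M j] of meager sets of the Cantor space, indexed by a
    well-order of type [K], and every such family yields a dominating family
    [h j] of functions. Call [c] almost even if it contains finitely many odd
    numbers; the almost even sets form a meager set, so fewer than [K] members of
    [X] are almost even. By recursion choose [d j], made of even numbers and
    sparser than [h j], independent of one fixed set [g] of even numbers, the
    earlier [d i], the almost even members of [X] and the finite sets. Then
    choose [y j = x + d j + g] with [x] in [X] outside fewer than [K] meager sets,
    which makes the span [Y] of the [y j] a Luzin group. By independence
    [x + y + g] is infinite for all [x] in [X] and [y] in [Y], so
    [(x, y) |-> x + y + g] maps [X * Y] continuously into the infinite sets. Its
    image contains every [d j], hence is dominating, which a continuous image of
    a Menger space cannot be. *)

(** * Cardinalities *)

Lemma card_le_inj T U (A : set T) (B : set U) (f : T -> U) :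
  (forall x, A x -> B (f x)) ->
  (forall x y, A x -> A y -> f x = f y -> x = y) -> A #<= B.
Proof.
move=> fAB finj; have /injfunPex[g] : exists2 f : T -> U, set_fun A B f & set_inj A f.
  by exists f => // x y; rewrite !inE; exact: finj.
exact: inj_card_le g.
Qed.

Lemma card_le_rel T U (A : set T) (B : set U) (G : T -> U -> Prop) :
  (forall x, A x -> exists2 y, B y & G x y) ->
  (forall x x' y, A x -> A x' -> G x y -> G x' y -> x = x') -> A #<= B.
Proof.
move=> GAB Ginj.
have [f fG] : {f : A -> B & forall x, G (val x) (val (f x))}.
  apply: (@choice _ _ (fun (x : A) (y : B) => G (val x) (val y))) => x.
  have [y By Gxy] := GAB _ (set_valP x).
  by exists (SigSub (mem_set By)).
apply/card_leP/injfunPex; exists f => // x x' _ _ e.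
apply/val_inj/(Ginj _ _ (val (f x)) (set_valP x) (set_valP x') (fG x)).
by rewrite e.
Qed.

(** Zorn's lemma applied to graphs of partial injections: a maximal one is total on [A] or onto [B],
    since otherwise the pair of two missed points could be added to it. *)
Lemma card_le_total T U (A : set T) (B : set U) : A #<= B \/ B #<= A.
Proof.
pose P (G : set (T * U)) := (forall p, G p -> A p.1 /\ B p.2) /\
  forall p q, G p -> G q -> (p.1 = q.1 <-> p.2 = q.2).
have [F FP Ftot|G [[GAB Ginj] Gmax]] := @Zorn_bigcup (T * U)%type P.
  split=> [p [X FX Xp]|p q [X FX Xp] [X' FX' Xq]].
    by have [+ _] := FP _ FX; apply.
  have [XX'|X'X] := Ftot _ _ FX FX'.
    by have [_] := FP _ FX'; apply=> //; exact: XX'.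
  by have [_] := FP _ FX; apply=> //; exact: X'X.
have [dom|/existsNP[a0 /not_implyP[Aa nGa]]] :=
    pselect (forall a, A a -> exists b, G (a, b)).
  left; apply: (@card_le_rel _ _ _ _ (fun a b => G (a, b))) => [a Aa|a a' b _ _ Ga Ga'].
    by have [b Gab] := dom _ Aa; exists b => //; have [] := GAB _ Gab.
  by have [_ /=] := Ginj _ _ Ga Ga'; apply.
have [ran|/existsNP[b0 /not_implyP[Bb nGb]]] :=
    pselect (forall b, B b -> exists a, G (a, b)).
  right; apply: (@card_le_rel _ _ _ _ (fun b a => G (a, b))) => [b Bb|b b' a _ _ Ga Ga'].
    by have [a Gab] := ran _ Bb; exists a => //; have [] := GAB _ Gab.
  by have [/= + _] := Ginj _ _ Ga Ga'; apply.
exfalso; apply: (Gmax (G `|` [set (a0, b0)])).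
  split=> [p|sub]; first by left.
  by apply: nGa; exists b0; apply: sub; right.
split=> [p [/GAB//|->//]|p q [Gp|->] [Gq|->]] /=; last by [].
- exact: Ginj.
- by split=> e; exfalso;
    [apply: nGa; exists p.2; rewrite -e|apply: nGb; exists p.1; rewrite -e];
    case: p Gp {e}.
- by split=> e; exfalso;
    [apply: nGa; exists q.2; rewrite e|apply: nGb; exists q.1; rewrite e];
    case: q Gq {e}.
Qed.

Lemma card_ltNle T U (A : set T) (B : set U) : card_lt A B <-> ~ (B #<= A).
Proof. by split=> [[]//|nBA]; split=> //; have [] := card_le_total A B. Qed.

Lemma card_le_lt_trans T U V (A : set T) (B : set U) (C : set V) :
  A #<= B -> card_lt B C -> card_lt A C.
Proof.
move=> AB [BC nCB]; split; first exact: card_le_trans BC.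
by move=> CA; apply: nCB; apply: card_le_trans AB.
Qed.

(** [regular_card] speaks of unions equal to [K] itself, so an injection [h] of [K] into the union
    is used to cut [K] into the preimages of the [F i]. *)
Lemma card_lt_bigcup T (K : set T) J V (D : set J) (F : J -> set V) :
  regular_card K -> card_lt D K -> (forall i, D i -> card_lt (F i) K) ->
  card_lt (\bigcup_(i in D) F i) K.
Proof.
move=> [_ Kreg] DK FK; apply/card_ltNle => KF.
(* The extension of [h] to all of [T] needs a default value in [V], so an empty [V] is handled
   apart. *)
have [V0|nV] := pselect (exists v : V, True); last first.
  have : K #<= [set: nat].
    apply: card_le_trans KF _; apply: (@card_le_inj _ _ _ _ (fun=> 0%N)) => // x.
    by case: nV; exists x.
  have [[i Di]|nD] := pselect (exists i, D i).
    have [_ +] := FK i Di; move=> nKF _; apply: nKF; apply: card_le_trans KF _.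
    by apply: subset_card_le => v; case: nV; exists v.
  have [_ nKD] := DK; move=> _; apply: nKD; apply: card_le_trans KF _.
  apply: (@card_le_rel _ _ _ _ (fun _ _ => True)) => [x|x]; case: nV; by exists x.
have {V0} [v0 _] := V0.
have [h hF hinj] : exists2 h : T -> V, set_fun K (\bigcup_(i in D) F i) h & set_inj K h.
  move: KF => /card_leP/injfunPex[f _ finj].
  exists (fun x => if pselect (K x) is left Kx then val (f (SigSub (mem_set Kx))) else v0).
    by move=> x Kx; case: pselect => // Kx'; exact: set_valP.
  move=> x y /set_mem Kx /set_mem Ky; case: pselect => // Kx'; case: pselect => // Ky'.
  move=> /val_inj/finj; rewrite !inE => /(_ I I).
  by case.
pose G i := K `&` h @^-1` F i.
apply: (Kreg (G @` D)).
- exact: card_le_lt_trans (card_image_le _ _) DK.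
- move=> _ [i Di <-]; apply: card_le_lt_trans (FK _ Di).
  apply: (@card_le_inj _ _ _ _ h) => [x []//|x y [Kx _] [Ky _]].
  by apply: hinj; rewrite inE.
- rewrite bigcup_image; apply/seteqP; split=> [x [i _ []//]|x Kx].
  by have [i Di Fi] := hF _ Kx; exists i.
Qed.

Lemma card_lt_finite T U (K : set T) (A : set U) :
  infinite_set K -> finite_set A -> card_lt A K.
Proof.
by move=> Kinf Afin; apply/card_ltNle => KA; apply: Kinf; apply: card_le_finite KA Afin.
Qed.

Lemma card_lt_setU T (K : set T) V (A B : set V) :
  regular_card K -> card_lt A K -> card_lt B K -> card_lt (A `|` B) K.
Proof.
move=> Kreg AK BK; have -> : A `|` B = \bigcup_(b in [set: bool]) (if b then A else B).
  apply/seteqP; split=> [x [Ax|Bx]|x [[] _ ?]];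
    [by exists true|by exists false|by left|by right].
apply: card_lt_bigcup => // [|[]//].
by apply: card_lt_finite; [case: Kreg|exact: finite_finset].
Qed.

(** This is the initial ordinal of [K]. Well-order [T]; if some point of [K] has at least [K]
    predecessors in [K], cut at the least such point [z], otherwise keep all of [K]. *)
Lemma initial_well_order T (K : set T) :
  exists (I : Type) (lt : I -> I -> Prop),
    [/\ [set: I] #= K, well_founded lt,
        forall i j k, lt i j -> lt j k -> lt i k,
        forall i j, [\/ lt i j, i = j | lt j i] &
        forall i, card_lt [set j | lt j i] K].
Proof.
have [R Rwo] := well_ordering_principle {classic T}.
pose lt (x y : {classic T}) := R x y /\ x <> y.
have wo (A : set T) : A !=set0 -> exists2 z, A z & forall x, A x -> x <> z -> lt z x.
  move=> [x Ax]; have [|z [[zA zmin] _]] := Rwo [pred x : {classic T} | `[< A x >]].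
    by exists x; apply/asboolP.
  exists z; first exact/asboolP.
  move=> y Ay yz; split; last exact/nesym.
  by apply: zmin; exact/asboolP.
have Rch := @wo_chainW {classic T} R predT (fun A _ => Rwo A).
have Rtot x y : R x y || R y x by exact: Rch.
have Ranti x y : R x y -> R y x -> x = y.
  move=> Rxy Ryx.
  apply: (@wo_chain_antisymmetric {classic T} R predT (fun A _ => Rwo A)) => //.
  exact/andP.
have lttri x y : [\/ lt x y, x = y | lt y x].
  have [->|xy] := pselect (x = y); first exact: Or32.
  by have /orP[Rxy|Ryx] := Rtot x y; [apply: Or31|apply: Or33; split => // /esym].
have lt_asym x y : lt x y -> ~ lt y x.
  by move=> [Rxy xy] [Ryx _]; apply: xy; exact: Ranti.
have lttrans x y z : lt x y -> lt y z -> lt x z.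
  move=> xy yz; have [|m] := wo [set x; y; z]; first by exists x; left; left.
  move=> [[->|->]|->] mmin.
  - by apply: mmin; [right|move=> zx; move: yz; rewrite zx; exact: lt_asym].
  - have : lt y x by apply: mmin; [left; left|move=> e; move: xy; rewrite e => -[]].
    by move/lt_asym.
  - have : lt z y by apply: mmin; [left; right|move=> e; move: yz; rewrite e => -[]].
    by move/lt_asym.
have ltwf : well_founded lt.
  move=> x; apply: contrapT => nx.
  have [|z nz zmin] := wo [set y | ~ Acc lt y]; first by exists x.
  apply: nz; constructor => y yz; apply: contrapT => ny.
  have [yz0|yz0] := pselect (y = z); first by move: yz => [_]; rewrite yz0.
  exact: lt_asym yz (zmin _ ny yz0).
have [W [WK Wini]] : exists W : set T, W #= K /\
    forall x, W x -> card_lt [set y | W y /\ lt y x] K.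
  pose B := [set x | K x /\ K #<= [set y | K y /\ lt y x]].
  have [Bne|B0] := pselect (B !=set0); last first.
    exists K; split=> // x Kx; apply/card_ltNle => KK; apply: B0; by exists x.
  have [z [Kz zK] zmin] := wo _ Bne.
  exists [set y | K y /\ lt y z]; split.
    by apply/card_eqPle; split=> //; apply: subset_card_le => y [].
  move=> x [Kx xz]; apply/card_ltNle => KK.
  have Bx : B x.
    split=> //; apply: card_le_trans KK _; apply: subset_card_le => y [[Ky _] yx].
    by split.
  have [xz0|xz0] := pselect (x = z); first by move: xz => [_]; rewrite xz0.
  exact: lt_asym xz (zmin _ Bx xz0).
exists W, (fun x y => lt (val x) (val y)); split.
- apply: card_eq_trans WK; apply/card_bijP.
  exists (fun w : [set: W] => val w).
  exists (fun w => SigSub (mem_set (I : [set: W] w))) => //.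
  by move=> x; exact: val_inj.
- move=> x; have [a xa] : exists a, val x = a by exists (val x).
  elim: (ltwf a) x xa => {}a _ IH x xa; constructor=> y yx.
  by apply: (IH (val y)); rewrite -?xa.
- by move=> x y z; exact: lttrans.
- move=> x y; have [?|/val_inj ?|?] := lttri (val x) (val y).
  + exact: Or31.
  + exact: Or32.
  + exact: Or33.
- move=> x; apply: card_le_lt_trans (Wini _ (set_valP x)).
  apply: (@card_le_inj _ _ _ _ val) => [y yx|y y' _ _ /val_inj//].
  by split=> //; exact: set_valP.
Qed.

(** * Meager subsets of the Cantor space *)

Lemma nowhere_denseP (T : topologicalType) (A : set T) :
  nowhere_dense A <-> forall O, open O -> O !=set0 ->
    exists P, [/\ open P, P !=set0, P `<=` O & forall x, P x -> ~ A x].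
Proof.
split=> [A0 O Oop [x Ox]|AO].
  exists (O `&` ~` closure A); split.
  - by apply: openI => //; rewrite openC; exact: closed_closure.
  - apply: contrapT => O0; suff : interior (closure A) x by rewrite A0.
    rewrite /interior nbhsE; exists O => // y Oy; apply: contrapT => nAy.
    by apply: O0; exists y.
  - by move=> y [].
  - by move=> y [_ nAy] /subset_closure.
rewrite /nowhere_dense -subset0 => x Ax.
have [| | P [Pop [y Py] PA dis]] := AO (interior (closure A)).
- exact: open_interior.
- by exists x.
- have /(_ P) [|z [Az Pz]] := interior_subset (PA _ Py).
    by rewrite nbhsE; exists P.
  exact: dis Az.
Qed.

Lemma sub_nowhere_dense (T : topologicalType) (A B : set T) :
  A `<=` B -> nowhere_dense B -> nowhere_dense A.
Proof.
move=> AB /nowhere_denseP B0; apply/nowhere_denseP => O Oop O0.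
have [P [? ? ? dis]] := B0 _ Oop O0; exists P; split=> // x Px /AB.
exact: dis.
Qed.

Lemma nowhere_denseU (T : topologicalType) (A B : set T) :
  nowhere_dense A -> nowhere_dense B -> nowhere_dense (A `|` B).
Proof.
move=> /nowhere_denseP A0 /nowhere_denseP B0; apply/nowhere_denseP => O Oop O0.
have [V1 [V1op V1ne V1O dis1]] := A0 _ Oop O0.
have [V2 [? ? V2V1 dis2]] := B0 _ V1op V1ne.
exists V2; split=> // [|x V2x [Ax|]]; first exact: subset_trans V1O.
  by apply: dis1 Ax; exact: V2V1.
exact: dis2.
Qed.

Lemma nowhere_dense0 (T : topologicalType) : nowhere_dense (@set0 T).
Proof. by apply/nowhere_denseP => O ? ?; exists O; split=> // x _ []. Qed.

Definition agree n (x y : cantor_space) := forall i, (i < n)%N -> x i = y i.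

Lemma agree_trans n x y z : agree n x y -> agree n y z -> agree n x z.
Proof. by move=> xy yz i ilt; rewrite xy// yz. Qed.

Lemma agree_leq n m x y : (n <= m)%N -> agree m x y -> agree n x y.
Proof. by move=> nm xy i ilt; apply: xy; exact: leq_trans nm. Qed.

Lemma near_agree (x : cantor_space) n : \forall y \near x, agree n x y.
Proof.
have coord i : \forall y \near x, x i = y i.
  have := @proj_continuous nat (fun=> bool) i x [set b | x i = b].
  apply; rewrite nbhs_principalE; by move=> b ->.
elim: n => [|n IH]; first by near=> y.
near=> y; move=> i; rewrite ltnS leq_eqVlt => /orP[/eqP->|].
  by near: y; exact: coord.
by move: i; near: y.
Unshelve. all: by end_near. Qed.

Lemma nbhs_cantorP (x : cantor_space) (A : set cantor_space) :
  nbhs x A <-> exists n, agree n x `<=` A.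
Proof.
split=> [|[n nA]]; last exact: filterS (near_agree x n).
(* The product topology is a supremum of coordinate topologies, so it suffices that the filter
   generated by the sets [agree n x] converges to [x] in each coordinate. *)
pose F := filter_from [set: nat] (fun n => agree n x : set cantor_space).
suff : F --> x by move=> Fx /Fx[n _ nA]; exists n.
have FF : Filter F.
  apply: filter_from_filter; first by exists 0%N.
  move=> n m _ _; exists (maxn n m) => // y xy.
  by split; apply: agree_leq xy; rewrite ?leq_maxl ?leq_maxr.
apply/cvg_sup => i B [/= _ [[C Cop <-] /= Cx] CB].
by exists i.+1 => // y xy; apply: CB => /=; rewrite -xy.
Qed.

Lemma nowhere_dense_cantorP (A : set cantor_space) : nowhere_dense A <->
  forall x n, exists y m, agree n x y /\ forall z, agree m y z -> ~ A z.
Proof.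
split=> [/nowhere_denseP A0 x n|A0].
  have [| |V [Vop [y Vy] Vx dis]] := A0 [set y | agree n x y].
  - rewrite openE => y /= xy; apply/nbhs_cantorP; exists n => z; exact: agree_trans.
  - by exists x.
  have /nbhs_cantorP[m mV] : nbhs y V by exact: open_nbhs_nbhs.
  by exists y, m; split; [exact: Vx|move=> z /mV/dis].
apply/nowhere_denseP => O Oop [x Ox].
have /nbhs_cantorP[n nO] : nbhs x O by exact: open_nbhs_nbhs.
have [y [m [xy dis]]] := A0 x n.
exists [set z | agree (maxn n m) y z]; split.
- rewrite openE => z /= yz; apply/nbhs_cantorP; exists (maxn n m) => w; exact: agree_trans.
- by exists y.
- move=> z /= yz; apply: nO; apply: agree_trans xy _.
  by apply: agree_leq yz; exact: leq_maxl.
- by move=> z /= yz; apply: dis; apply: agree_leq yz; exact: leq_maxr.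
Qed.

Lemma symdiffE a b i : symdiff a b i = a i (+) b i.
Proof. by rewrite /symdiff; case: (a i); case: (b i). Qed.

Lemma symdiffA a b c : symdiff a (symdiff b c) = symdiff (symdiff a b) c.
Proof. by apply/funext => i; rewrite !symdiffE addbA. Qed.

Lemma symdiffC a b : symdiff a b = symdiff b a.
Proof. by apply/funext => i; rewrite !symdiffE addbC. Qed.

Lemma symdiff0x a : symdiff empty_pt a = a.
Proof. by apply/funext => i; rewrite symdiffE. Qed.

Lemma symdiffx0 a : symdiff a empty_pt = a.
Proof. by rewrite symdiffC symdiff0x. Qed.

Lemma symdiffK a b : symdiff a (symdiff a b) = b.
Proof. by apply/funext => i; rewrite !symdiffE addKb. Qed.

Lemma nowhere_dense_translate (A : set cantor_space) a :
  nowhere_dense A -> nowhere_dense [set x | A (symdiff a x)].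
Proof.
move=> /nowhere_dense_cantorP A0; apply/nowhere_dense_cantorP => x k.
have [y [m [xy dis]]] := A0 (symdiff a x) k.
exists (symdiff a y), m; split=> [i ik|z yz /=].
  by rewrite symdiffE -xy// symdiffE addKb.
by apply: dis => i im; rewrite symdiffE -yz// symdiffE addKb.
Qed.

Lemma meager_translate (M : set cantor_space) a :
  meager M -> meager [set x | M (symdiff a x)].
Proof.
move=> [F [F0 ->]]; exists (fun n => [set x | F n (symdiff a x)]); split=> [n|].
  exact: nowhere_dense_translate.
by apply/seteqP; split=> x [n _ ?]; exists n.
Qed.

Lemma nowhere_dense_set1 (x : cantor_space) : nowhere_dense [set x].
Proof.
apply/nowhere_dense_cantorP => y n.
exists (fun i => if (i < n)%N then y i else ~~ x i), n.+1; split.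
  by move=> i ->.
by move=> z /(_ n (leqnn _)); rewrite ltnn => nxz /= zx; move: nxz; rewrite zx; case: (x n).
Qed.

Lemma meager_set1 (x : cantor_space) : meager [set x].
Proof.
exists (fun=> [set x]); split; last by rewrite bigcup_const.
by move=> _; exact: nowhere_dense_set1.
Qed.

(** * Subgroups spanned by a set, and transfinite recursion *)

Section Span.
Implicit Types (S : set cantor_space) (a b : cantor_space).

(** Every element is its own inverse, so the finite sums of members of [S] form the generated
    subgroup. *)
Inductive gspan S : set cantor_space :=
| gspan0 : gspan S empty_pt
| gspanS a b : S a -> gspan S b -> gspan S (symdiff a b).

Lemma gspan_sub S : S `<=` gspan S.
Proof. by move=> a Sa; rewrite -(symdiffx0 a); apply: gspanS => //; exact: gspan0. Qed.

Lemma gspanD S a b : gspan S a -> gspan S b -> gspan S (symdiff a b).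
Proof.
elim=> [|{}a c Sa _ IH] Sb; first by rewrite symdiff0x.
by rewrite -symdiffA; apply: gspanS => //; exact: IH.
Qed.

Lemma gspan_min S (G : set cantor_space) :
  symdiff_subgroup G -> S `<=` G -> gspan S `<=` G.
Proof. by move=> [G0 GD] SG a; elim=> // {}a b /SG Ga _; exact: GD. Qed.

Lemma gspan_subgroup S : symdiff_subgroup (gspan S).
Proof. by split; [exact: gspan0|exact: gspanD]. Qed.

Lemma gspan_mono S S' : S `<=` S' -> gspan S `<=` gspan S'.
Proof.
by move=> SS'; apply: gspan_min (gspan_subgroup _) _ => a /SS'; exact: gspan_sub.
Qed.

(** [G n] holds the sums of [n] generators, so the span is a countable union of sets of size below
    [K]; here [K] has to be uncountable. *)
Lemma card_lt_gspan T (K : set T) S :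
  regular_card K -> card_lt [set: nat] K -> card_lt S K -> card_lt (gspan S) K.
Proof.
move=> Kreg Kunc SK.
pose G := fix G n := if n is n.+1 then \bigcup_(a in S) (symdiff a @` G n)
                     else [set empty_pt].
suff : card_lt (\bigcup_n G n) K.
  apply: card_le_lt_trans; apply: subset_card_le => a.
  elim=> [|{}a b Sa _ [n _ Gb]]; first by exists 0%N.
  by exists n.+1 => //; exists a => //; exists b.
apply: card_lt_bigcup => // n _; elim: n => [|n IH] /=.
  by apply: card_lt_finite; [case: Kreg|exact: finite_set1].
apply: card_lt_bigcup => // a _.
exact: card_le_lt_trans (card_image_le _ _) IH.
Qed.

(** Terms with equal index cancel in pairs, so a sum that does not vanish can be written with a top
    index occurring exactly once. *)
Lemma gspan_last (J : Type) (lt : J -> J -> Prop) (y : J -> cantor_space) :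
  well_founded lt -> (forall i j k, lt i j -> lt j k -> lt i k) ->
  (forall i j, [\/ lt i j, i = j | lt j i]) ->
  forall e, gspan (range y) e -> e = empty_pt \/
    exists i s, gspan (y @` [set j | lt j i]) s /\ e = symdiff s (y i).
Proof.
move=> ltwf lttrans lttri.
pose dec (U : set J) e := e = empty_pt \/
    exists i s, [/\ U i, gspan (y @` [set j | lt j i]) s & e = symdiff s (y i)].
have step (U : set J) : (forall i j, U i -> lt j i -> U j) ->
    (forall i, U i -> gspan (y @` [set j | lt j i]) `<=` dec [set j | lt j i]) ->
    gspan (y @` U) `<=` dec U.
  move=> Udown Uini e; elim=> [|_ b [k Uk <-] _ [->|[i [s [Ui si ->]]]]].
  - by left.
  - right; exists k, empty_pt; split=> //; first exact: gspan0.
    by rewrite symdiffx0 symdiff0x.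
  - have [ki|ki|ik] := lttri k i; [right| |right].
    + exists i, (symdiff (y k) s); split=> //; last by rewrite symdiffA.
      by apply: gspanS si; exists k.
    (* The new generator cancels the top one; what remains is [s], which is decomposed by the
       hypothesis on the smaller segment. *)
    + rewrite ki (symdiffC s) symdiffK.
      have [->|[j [s' [ji ? ->]]]] := Uini i Ui s si; first by left.
      by right; exists j, s'; split=> //; exact: Udown ji.
    + exists k, (symdiff s (y i)); split=> //; last by rewrite symdiffC.
      apply: gspanD; last by apply: gspan_sub; exists i.
      by apply: gspan_mono si; apply: image_subset => j /= ji; exact: lttrans ik.
have ini i : gspan (y @` [set j | lt j i]) `<=` dec [set j | lt j i].
  elim: (ltwf i) => {}i _ IH; apply: step => [j k /= ji kj|j /= ji].
    exact: lttrans ji.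
  exact: IH.
move=> e /(step setT)-/(_ (fun _ _ _ _ => I) (fun i _ => ini i)) [->|[i [s [_ ? ->]]]].
  by left.
by right; exists i, s.
Qed.

End Span.

(** Well-founded recursion in which a requirement sees only the set of earlier values. The size
    bound on that set is what lets a cardinality argument supply the next value. *)
Lemma transfinite_choice (I V : Type) (lt : I -> I -> Prop)
    (Q : I -> set V -> V -> Prop) :
  well_founded lt ->
  (forall i S, S #<= [set j | lt j i] -> exists v, Q i S v) ->
  exists u : I -> V, forall i, Q i (u @` [set j | lt j i]) (u i).
Proof.
move=> ltwf exQ.
pose prev i (f : forall j, lt j i -> V) : set V :=
  [set v | exists j (h : lt j i), v = f j h].
have prevP i f : exists v, Q i (prev i f) v.
  apply: exQ; apply: (@card_le_rel _ _ _ _ (fun v j => exists h : lt j i, v = f j h)).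
    by move=> v [j [h ->]]; exists j => //; exists h.
  by move=> v v' j _ _ [h ->] [h' ->]; rewrite (Prop_irrelevance h h').
pose F i f := projT1 (cid (prevP i f)).
exists (Fix ltwf (fun=> V) F) => i.
have -> : Fix ltwf (fun=> V) F i = F i (fun j _ => Fix ltwf (fun=> V) F j).
  apply: (Fix_eq ltwf (fun=> V)) => x f g fg; congr (F _ _).
  by apply: functional_extensionality_dep => j; apply: functional_extensionality_dep => h.
rewrite /F; case: cid => v /=; congr (Q _ _ _).
by apply/seteqP; split=> w [j]; [move=> [h ->]; exists j|move=> h <-; exists j, h].
Qed.

(** * Domination *)

(** One coordinate at a time: letting bit [a] vary adds only the translate by the point [e] whose
    sole bit is at [a]. *)
Lemma nowhere_dense_tail (A : set cantor_space) a : nowhere_dense A ->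
  nowhere_dense [set x : cantor_space | exists2 y, A y & forall i, (a <= i)%N -> x i = y i].
Proof.
move=> A0; elim: a => [|a]; last set Aa := (X in nowhere_dense X) => Aa0.
  apply: sub_nowhere_dense A0 => x [y Ay xy].
  by rewrite (_ : x = y)//; apply/funext => i; exact: xy.
pose e : cantor_space := fun i => i == a.
apply: sub_nowhere_dense (nowhere_denseU Aa0 (nowhere_dense_translate e Aa0)).
move=> x [y Ay xy].
have [xya|xya] := eqVneq (x a) (y a); [left|right]; exists y => // i; rewrite leq_eqVlt.
  by move=> /orP[/eqP<-//|/xy].
rewrite symdiffE /e => /orP[/eqP<-|ai].
  by rewrite eqxx; case: (x a) (y a) xya => [] [].
by rewrite gtn_eqF// xy.
Qed.

Lemma nowhere_dense_bigcup (T : topologicalType) (F : nat -> set T) n :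
  (forall k, nowhere_dense (F k)) -> nowhere_dense (\bigcup_(k < n) F k).
Proof.
move=> F0; elim: n => [|n IH].
  by apply: sub_nowhere_dense (@nowhere_dense0 T) => x [].
apply: sub_nowhere_dense (nowhere_denseU IH (F0 n)) => x [k /=].
by rewrite ltnS leq_eqVlt => /orP[/eqP->|kn] Fkx; [right|left; exists k].
Qed.

Lemma incr_interval_inj (g : nat -> nat) n m i : (forall n, (g n < g n.+1)%N) ->
  (g n <= i < g n.+1)%N -> (g m <= i < g m.+1)%N -> n = m.
Proof.
move=> glt /andP[ni in1] /andP[mi im1].
have mono : {homo g : a b / (a <= b)%N}.
  by apply: homo_leq => [//||k]; [exact: leq_trans|exact: ltnW].
by have [nm|mn|//] := ltngtP n m; [have := mono _ _ nm|have := mono _ _ mn]; lia.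
Qed.

(* Talagrand's interval description of meager sets. Ending each block of the
   pattern with [true] is a normalisation used to dominate: a set that follows
   the pattern on some blocks and is full elsewhere has no long gaps. *)
Lemma meager_pattern (M : set cantor_space) : meager M ->
  exists (g : nat -> nat) (t : cantor_space),
    [/\ forall n, (g n < g n.+1)%N, forall n, t (g n.+1).-1 &
        forall x, (forall m, exists2 n, (m <= n)%N &
          forall i, (g n <= i < g n.+1)%N -> x i = t i) -> ~ M x].
Proof.
move=> [F [F0 ->]].
(* From [(n, a)] a block starting at [a] is built whose pattern avoids the first [n + 1] sets,
   whatever the bits before [a] are. *)
have next (na : nat * nat) : exists bs : nat * cantor_space,
    [/\ (na.2 < bs.1)%N, bs.2 bs.1.-1 &
        forall x, (forall i, (na.2 <= i < bs.1)%N -> x i = bs.2 i) ->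
        ~ (\bigcup_(k < na.1.+1) F k) x].
  case: na => n a.
  have /nowhere_dense_cantorP/(_ empty_pt a)[y [m [_ dis]]] :=
    nowhere_dense_tail a (nowhere_dense_bigcup n.+1 F0).
  (* Avoidance depends only on the first [m] coordinates, so the bit at [maxn a m] is free to be set
     to [true]. *)
  exists ((maxn a m).+1, fun i => (i == maxn a m) || y i); split => [||x xs Fx].
  - by rewrite ltnS leq_maxl.
  - by rewrite /= eqxx.
  - apply: (dis (fun i => if (i < a)%N then y i else x i)).
      move=> i im; case: ltnP => // ai; rewrite xs/=; last by lia.
      by rewrite ltn_eqF//; lia.
    by exists x => // i ai; rewrite ltnNge ai.
have [B Bnext] := choice next.
pose g := fix g n := if n is n.+1 then (B (n, g n)).1 else 0%N.
have glt n : (g n < g n.+1)%N by have [] := Bnext (n, g n).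
pose t : cantor_space := fun i =>
  `[< exists2 n, (g n <= i < g n.+1)%N & (B (n, g n)).2 i >].
have tE n i : (g n <= i < g n.+1)%N -> t i = (B (n, g n)).2 i.
  move=> ni; apply/asboolP/idP => [[m mi]|Bi]; last by exists n.
  by rewrite (incr_interval_inj glt ni mi).
exists g, t; split=> // [n|x xt [k _ Fkx]].
  rewrite (tE n); first by have [_ +] := Bnext (n, g n).
  by have := glt n; lia.
have [n kn xtn] := xt k.
have [_ _ /(_ x)] := Bnext (n, g n); apply; last by exists k.
by move=> i ni; rewrite xtn// (tE n).
Qed.

(** For fixed [k0], a finite piece of length [n] continued by zeros up to [f (maxn n k0)] misses the
    interval that starts at [maxn n k0]. *)
Lemma meager_hitting (f : nat -> nat) :
  meager [set x : cantor_space | exists k0, forall k, (k0 <= k)%N ->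
    exists2 i, (k <= i < f k)%N & x i].
Proof.
exists (fun k0 => [set x : cantor_space | forall k, (k0 <= k)%N ->
    exists2 i, (k <= i < f k)%N & x i]); split=> [k0|]; last first.
  by apply/seteqP; split=> x [k]; exists k.
apply/nowhere_dense_cantorP => x n.
exists (fun i => (i < n)%N && x i), (f (maxn n k0)); split=> [i ->//|z yz zhit].
have [i ni] := zhit _ (leq_maxr n k0).
by rewrite -yz; [case: ltnP => //; lia|lia].
Qed.

(** If [f n] exceeded the end [g n.+1] of block [n] infinitely often, the set following the pattern
    on those blocks and full elsewhere would avoid [M], yet meet every interval from [k] to
    [f k]. *)
Lemma meager_dominating (M : set cantor_space) : meager M ->
  exists h : nat -> nat, forall f : nat -> nat,
    {homo f : m n / (m <= n)%N} -> (forall k, (k < f k)%N) ->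
    [set x : cantor_space | exists k0, forall k, (k0 <= k)%N ->
      exists2 i, (k <= i < f k)%N & x i] `<=` M ->
    exists n0, forall n, (n0 <= n)%N -> (f n <= h n)%N.
Proof.
move=> /meager_pattern[g [t [glt tend tM]]]; exists (fun n => g n.+1) => f fmono flt fM.
apply: contrapT => /forallNP nf.
have {}nf n0 : exists2 n, (n0 <= n)%N & (g n.+1 < f n)%N.
  have /existsNP[n /not_implyP[n0n /negP]] := nf n0.
  by rewrite -ltnNge => ?; exists n.
have gge n : (n <= g n)%N by elim: n => // n IH; exact: leq_ltn_trans (glt n).
pose P i n := (g n.+1 < f n)%N /\ (g n <= i < g n.+1)%N.
pose x : cantor_space := fun i => if pselect (exists n, P i n) then t i else true.
apply: (tM x); last apply: fM.
  move=> m; have [n mn fn] := nf m; exists n => // i ni.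
  by rewrite /x; case: pselect => // -[]; exists n.
exists 0%N => k _; have [[n [fn nk]]|nP] := pselect (exists n, P k n).
  (* The block of [k] ends with [true], and its end lies below [f k]: from [n <= g n <= k] comes
     [g n.+1 < f n <= f k]. *)
  exists (g n.+1).-1.
    have : (f n <= f k)%N by apply: fmono; apply: leq_trans (gge n) _; lia.
    by lia.
  by rewrite /x; case: pselect => [?|//]; exact: tend.
by exists k; [rewrite leqnn flt|rewrite /x; case: pselect].
Qed.

Lemma meager_cofinal_dominating (J : Type) (M : J -> set cantor_space) :
  (forall j, meager (M j)) ->
  (forall A : set cantor_space, meager A -> exists j, A `<=` M j) ->
  exists h : J -> nat -> nat, forall f : nat -> nat,
    exists j n0, forall n, (n0 <= n)%N -> (f n <= h j n)%N.
Proof.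
move=> M0 Mcof; have /choice[h hP] := fun j => meager_dominating (M0 j).
(* [f'] lies above [f], is nondecreasing and exceeds the identity, as [meager_dominating] asks. *)
exists h => f; pose f' n := (\sum_(i < n.+1) f i + n.+1)%N.
have ff' n : (f n <= f' n)%N by rewrite /f' big_ord_recr/=; lia.
have [j fj] := Mcof _ (meager_hitting f').
have f'mono : {homo f' : m n / (m <= n)%N}.
  apply: homo_leq => [//||n]; first exact: leq_trans.
  by rewrite /f' [X in (_ <= X + _)%N]big_ord_recr/=; lia.
have f'lt k : (k < f' k)%N by rewrite /f'; lia.
have [n0 n0P] := hP j f' f'mono f'lt fj.
by exists j, n0 => n /n0P; exact: leq_trans.
Qed.

(** * From the line to the Cantor space *)

Section BinaryExpansion.
Local Open Scope ring_scope.
Context {R : realType}.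
Implicit Types (x y : cantor_space) (r c d : R).

Definition dyadic x n : R := \sum_(i < n) (x i)%:R * 2^-1 ^+ i.+1.

(** The number in the unit interval with binary digits [x]; the intervals are closed, so a dyadic
    rational strictly inside has both of its expansions. *)
Definition expands x r := forall n, dyadic x n <= r <= dyadic x n + 2^-1 ^+ n.

Lemma dyadicS x n : dyadic x n.+1 = dyadic x n + (x n)%:R * (2^-1 ^+ n / 2).
Proof. by rewrite /dyadic big_ord_recr/= exprSr. Qed.

Lemma half_gt0 n : 0 < 2^-1 ^+ n :> R.
Proof. by rewrite exprn_gt0. Qed.

Lemma eq_dyadic x y n : agree n x y -> dyadic x n = dyadic y n.
Proof. by move=> xy; apply: eq_bigr => i _; rewrite xy. Qed.

Lemma dyadic_nest x n m : (n <= m)%N ->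
  dyadic x n <= dyadic x m /\ dyadic x m + 2^-1 ^+ m <= dyadic x n + 2^-1 ^+ n.
Proof.
elim: m => [|m IH]; first by rewrite leqn0 => /eqP->.
rewrite leq_eqVlt => /orP[/eqP-> //|/IH[nm mn]].
rewrite dyadicS exprSr; have := half_gt0 m.
by case: (x m) => /=; lra.
Qed.

Lemma expands_ex x : exists r, expands x r.
Proof.
pose S : set R := range (dyadic x).
have Sub n : ubound S (dyadic x n + 2^-1 ^+ n).
  move=> _ [m _ <-]; have [nm|mn] := leqP n m.
    have [_] := dyadic_nest x nm; have := half_gt0 m; lra.
  by have [+ _] := dyadic_nest x (ltnW mn); have := half_gt0 n; lra.
have Ssup : has_sup S.
  by split; [exists (dyadic x 0), 0%N|exists (dyadic x 0 + 2^-1 ^+ 0)].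
exists (sup S) => n; apply/andP; split.
  by apply: sup_upper_bound => //; exists n.
by apply: ge_sup => //; exists (dyadic x 0), 0%N.
Qed.

Lemma dyadic_find x n r m : dyadic x n <= r < dyadic x n + 2^-1 ^+ n ->
  exists y, agree n x y /\ dyadic y (n + m) <= r < dyadic y (n + m) + 2^-1 ^+ (n + m).
Proof.
move=> xr; elim: m => [|m [y [xy yr]]]; first by exists x; rewrite addn0.
(* The next digit compares [r] with the midpoint of the current interval. *)
pose b := dyadic y (n + m) + 2^-1 ^+ (n + m) / 2 <= r.
pose z : cantor_space := fun i => if (i < n + m)%N then y i else b.
have yz : agree (n + m) y z by move=> i; rewrite /z => ->.
exists z; split; first by apply: agree_trans xy _; apply: agree_leq yz; exact: leq_addr.
have zb : z (n + m)%N = b by rewrite /z ltnn.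
rewrite addnS dyadicS -(eq_dyadic yz) exprSr zb.
by have [br|br] := boolP b; move: br; rewrite /b -?ltNge => br /=; lra.
Qed.

Lemma dyadic_sep x y n : [\/ agree n x y, dyadic x n + 2^-1 ^+ n <= dyadic y n |
  dyadic y n + 2^-1 ^+ n <= dyadic x n].
Proof.
elim: n => [|n [xy|xy|xy]]; first by apply: Or31.
- rewrite !dyadicS exprSr (eq_dyadic xy); have [xyn|] := eqVneq (x n) (y n).
    apply: Or31 => i; rewrite ltnS leq_eqVlt => /orP[/eqP->//|]; exact: xy.
  have := half_gt0 n.
  by case: (x n) (y n) => [] [] //= h _; [apply: Or33|apply: Or32]; lra.
- apply: Or32; rewrite !dyadicS exprSr; have := half_gt0 n.
  by case: (x n) (y n) => [] [] /=; lra.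
- apply: Or33; rewrite !dyadicS exprSr; have := half_gt0 n.
  by case: (x n) (y n) => [] [] /=; lra.
Qed.

Lemma half_lt e : 0 < e -> exists n, 2^-1 ^+ n < e :> R.
Proof.
move=> e0; exists (Num.bound e^-1); rewrite exprVn -ltf_pV2 ?posrE ?invr_gt0 ?exprn_gt0//.
by rewrite invrK; exact: upper_nthrootP.
Qed.

(** Following the digits of the midpoint of [c] and [d] until the interval is shorter than half of
    [d - c] brings it strictly between them. *)
Lemma dyadic_sub x n c d : c < d -> dyadic x n <= c -> d <= dyadic x n + 2^-1 ^+ n ->
  exists y m, [/\ agree n x y, (n <= m)%N, c < dyadic y m &
    dyadic y m + 2^-1 ^+ m < d].
Proof.
move=> cd xc dx; pose r := (c + d) / 2.
have [k kr] : exists k, 2^-1 ^+ k < (d - c) / 2 by apply: half_lt; lra.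
have [|y [xy yr]] := @dyadic_find x n r k; first by rewrite /r; lra.
have nk : 2^-1 ^+ (n + k) <= 2^-1 ^+ k :> R.
  rewrite exprD ler_piMl ?exprn_ge0// exprn_ile1//; lra.
exists y, (n + k)%N; split=> //; first exact: leq_addr.
  by move: yr nk kr; rewrite /r; lra.
by move: yr nk kr; rewrite /r; lra.
Qed.

Lemma nowhere_dense_realP (A : set R) : nowhere_dense A <->
  forall c d, c < d -> exists c' d', [/\ c < c', c' < d', d' < d &
    forall r, c' < r < d' -> ~ A r].
Proof.
split=> [/nowhere_denseP A0 c d cd|A0].
  have [| |P [Pop [p Pp] Pcd dis]] := A0 [set` `]c, d[].
  - exact: itv_open.
  - by exists ((c + d) / 2); rewrite /= in_itv/=; lra.
  have /nbhs_ballP[e e0 eP] : nbhs p P by exact: open_nbhs_nbhs.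
  have := Pcd _ Pp; rewrite /= in_itv/= => cpd.
  pose d' := Num.min (p + e / 2) ((p + d) / 2).
  have [pd' d'd d'e] : [/\ p < d', d' < d & d' <= p + e / 2].
    move: e0 => /= e0; rewrite /d' lt_min gt_min ge_min lexx; split=> //.
      by apply/andP; lra.
    by apply/orP; right; lra.
  exists p, d'; split=> // [|r pr]; first lra.
  by apply: dis; apply: eP; rewrite /ball/= ltr_norml; lra.
apply/nowhere_denseP => P Pop [p Pp].
have /nbhs_ballP[e e0 eP] : nbhs p P by exact: open_nbhs_nbhs.
have [|c [d [pc cd dp dis]]] := A0 (p - e) (p + e); first by move: e0 => /=; lra.
exists [set` `]c, d[]; split.
- exact: itv_open.
- by exists ((c + d) / 2); rewrite /= in_itv/=; lra.
- by move=> r; rewrite /= in_itv/= => cr; apply: eP; rewrite /ball/= ltr_norml; lra.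
- by move=> r; rewrite /= in_itv/=; exact: dis.
Qed.

Lemma nowhere_dense_expands_image (A : set cantor_space) : nowhere_dense A ->
  nowhere_dense [set r | exists2 x, A x & expands x r].
Proof.
move=> /nowhere_dense_cantorP A0; apply/nowhere_dense_realP => c d cd.
have range01 x r : expands x r -> 0 <= r <= 1.
  by move=> /(_ 0%N); rewrite /dyadic big_ord0 expr0 add0r.
have [dle0|d0] := leP d 0.
  exists (c + (d - c) / 3), (d - (d - c) / 3); split; try lra.
  by move=> r cr [x _ /range01]; lra.
have [cge1|c1] := leP 1 c.
  exists (c + (d - c) / 3), (d - (d - c) / 3); split; try lra.
  by move=> r cr [x _ /range01]; lra.
have [c' [d' [c'd' c'0 d'1 cc' d'd]]] :
    exists c' d', [/\ c' < d', 0 <= c', d' <= 1, c <= c' & d' <= d].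
  exists (Num.max 0 c), (Num.min 1 d).
  rewrite le_max lexx ge_min lexx le_max lexx orbT ge_min lexx orbT; split=> //.
  by rewrite gt_max !lt_min; lra.
have [| |x [n [_ _ cx xd]]] := @dyadic_sub empty_pt 0 c' d' c'd'.
- by rewrite /dyadic big_ord0.
- by rewrite /dyadic big_ord0 expr0 add0r.
have [y [m [xy dis]]] := A0 x n.
pose k := maxn n m.
have [ny yn] := dyadic_nest y (leq_maxl n m).
have := half_gt0 k; rewrite -/k -(eq_dyadic xy) in ny yn *; move=> k0.
(* The middle third contains no endpoint of a [k]-digit interval, so any [z] expanding to a number
   [r] there shares the first [k] digits of [y]. *)
exists (dyadic y k + 2^-1 ^+ k / 3), (dyadic y k + 2^-1 ^+ k * 2 / 3); split; try lra.
move=> r yr [z Az zr]; apply: (dis z) Az.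
apply: agree_leq (leq_maxr n m) _; rewrite -/k.
have := zr k; have [//|yz|zy] := dyadic_sep y z k; lra.
Qed.

Lemma nowhere_dense_expands_preimage (A : set R) : nowhere_dense A ->
  nowhere_dense [set x | exists2 r, A r & expands x r].
Proof.
move=> /nowhere_dense_realP A0; apply/nowhere_dense_cantorP => x n.
have [|c [d [xc cd dx dis]]] := A0 (dyadic x n) (dyadic x n + 2^-1 ^+ n).
  by have := half_gt0 n; lra.
have [y [m [xy nm cy yd]]] := dyadic_sub cd (ltW xc) (ltW dx).
exists y, m; split=> // z yz [r Ar /(_ m)].
by rewrite -(eq_dyadic yz) => zr; apply: dis Ar; lra.
Qed.

Lemma meager_expands_image (A : set cantor_space) : meager A ->
  meager [set r | exists2 x, A x & expands x r].
Proof.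
move=> [F [F0 ->]]; exists (fun n => [set r | exists2 x, F n x & expands x r]).
split=> [n|]; first exact: nowhere_dense_expands_image.
apply/seteqP; split=> [r [x [n _ Fx] xr]|r [n _ [x Fx xr]]].
  by exists n => //; exists x.
by exists x => //; exists n.
Qed.

Lemma meager_expands_preimage (A : set R) : meager A ->
  meager [set x | exists2 r, A r & expands x r].
Proof.
move=> [F [F0 ->]]; exists (fun n => [set x | exists2 r, F n r & expands x r]).
split=> [n|]; first exact: nowhere_dense_expands_preimage.
apply/seteqP; split=> [x [r [n _ Fr] xr]|x [n _ [r Fr xr]]].
  by exists n => //; exists r.
by exists r => //; exists n.
Qed.

End BinaryExpansion.

(** A meager [A] is carried to a meager set of reals; a member [M] of the family above it pulls back
    to a meager set containing [A], because every [x] is the expansion of some real. *)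
Lemma meager_cofinal_cantor (R : realType) (F : set (set R)) :
  meager_cofinal F ->
  let N (M : set R) := [set x : cantor_space | exists2 r, M r & expands x r] in
  (forall M, F M -> meager (N M)) /\
  forall A : set cantor_space, meager A -> exists2 M, F M & A `<=` N M.
Proof.
move=> [Fmeager Fcof] N; split=> [M /Fmeager|A A0]; first exact: meager_expands_preimage.
have [M [FM AM]] := Fcof _ (meager_expands_image A0).
exists M => // x Ax; have [r xr] := @expands_ex R x.
by exists r => //; apply: AM; exists x.
Qed.

(** * Construction of the group *)

Lemma card_eq_range T J (A : set T) :
  A #= [set: J] -> exists e : J -> T, range e = A.
Proof.
move=> /card_bijP[f [f' fK f'K]].
exists (fun j => val (f' (SigSub (mem_set (I : [set: J] j))))).
apply/seteqP; split=> [_ [j _ <-]|x Ax]; first exact: set_valP.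
exists (val (f (SigSub (mem_set Ax)))) => //.
rewrite [X in f' X](_ : _ = f (SigSub (mem_set Ax))) ?fK//.
exact: val_inj.
Qed.

(** Were [K] countable, a countably infinite part of [X] would be a meager set meeting [X] in at
    least [K] points. *)
Lemma luzin_uncountable T (K : set T) (X : set cantor_space) :
  infinite_set K -> luzin_set K X -> card_lt [set: nat] K.
Proof.
move=> Kinf [KX XM]; apply/card_ltNle => Knat.
have /infiniteP/card_leP/injfunPex[f _ finj] : infinite_set X.
  by apply: contra_not Kinf; exact: card_le_finite.
pose a n : cantor_space := val (f (SigSub (mem_set (I : [set: nat] n)))).
have ainj : injective a by move=> n m /val_inj/finj; rewrite !inE => /(_ I I)[].
have /XM : meager (range a).
  exists (fun n => [set a n]); split=> [n|]; first exact: nowhere_dense_set1.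
  by apply/seteqP; split=> [_ [n _ <-]|x [n _ ->]]; exists n.
move=> [_]; apply; apply: card_le_trans Knat _.
apply: (@card_le_inj _ _ _ _ a) => [n _|n m _ _ /ainj//].
by split; [exact: set_valP|exists n].
Qed.

Definition finite_support (z : cantor_space) :=
  exists a, forall i, (a <= i)%N -> z i = false.

Definition single n : cantor_space := fun i => i == n.

Lemma finite_support_gspan z : finite_support z -> gspan (range single) z.
Proof.
move=> [a]; elim: a z => [|a IH] z za.
  by rewrite (_ : z = empty_pt); [exact: gspan0|apply/funext => i; exact: za].
have [zat|zaf] := boolP (z a); last first.
  by apply: IH => i; rewrite leq_eqVlt => /orP[/eqP<-|/za//]; exact/negbTE.
rewrite -(symdiffK (single a) z); apply: gspanS; first by exists a.
apply: IH => i; rewrite symdiffE /single leq_eqVlt => /orP[/eqP<-|ai].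
  by rewrite eqxx zat.
by rewrite gtn_eqF// za.
Qed.

Definition even_support (d : cantor_space) := forall i, odd i -> d i = false.

Lemma even_support_subgroup : symdiff_subgroup even_support.
Proof.
by split=> // a b ea eb i oi; rewrite symdiffE ea// eb.
Qed.

Lemma meager_almost_even :
  meager [set x : cantor_space | exists a, forall i, (a <= i)%N -> odd i -> x i = false].
Proof.
exists (fun a => [set x : cantor_space | forall i, (a <= i)%N -> odd i -> x i = false]).
split=> [a|]; last by apply/seteqP; split=> x [a]; exists a.
apply/nowhere_dense_cantorP => x n.
exists (fun i => if (i < n)%N then x i else true), (2 * (n + a)).+2; split=> [i ->//|z yz].
move=> /(_ (2 * (n + a)).+1); rewrite -yz; last by lia.
case: ltnP => [|_ /(_ _ _)]; first by lia.
by move=> h; suff : true = false by []; apply: h; lia.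
Qed.

(* The n-th element of such a [d] is at least [h n]. *)
Definition sparse (h : nat -> nat) (d : cantor_space) :=
  forall n m, (m <= h n)%N -> (\sum_(i < m) d i <= n)%N.

(** A coding of [X]: the [n]-th element of [d x] is [4 * p n] or [4 * p n + 2] according to the bit
    [x n], so [d] is injective and yields at least [K] sparse even sets, too many for [B]. *)
Lemma even_sparse_ex T (K : set T) (X B : set cantor_space) h :
  K #<= X -> card_lt B K -> exists d, [/\ even_support d, sparse h d & ~ B d].
Proof.
move=> KX [_ nKB].
pose p n := (\sum_(k < n.+1) (h k).+1)%N.
have plt n : (p n < p n.+1)%N by rewrite /p (big_ord_recr n.+1)/=; lia.
have pmono : {mono p : a b / (a <= b)%N}.
  by apply: leq_mono; apply: homo_ltn => //; exact: ltn_trans.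
have ph n : (h n < p n)%N by rewrite /p big_ord_recr/=; lia.
pose c (x : cantor_space) n := (4 * p n + 2 * x n)%N.
pose d (x : cantor_space) : cantor_space := fun i => `[< exists n, i = c x n >].
have dinj x y : d x = d y -> x = y.
  move=> dxy; apply/funext => n.
  have : d x (c x n) by apply/asboolP; exists n.
  rewrite dxy => /asboolP[k]; rewrite /c.
  have [ltnk|ltkn|<-] := ltngtP n k.
  - have := plt n; have : (p n < p k)%N by rewrite ltnNge pmono -ltnNge.
    by case: (x n) (y k) => [] []; lia.
  - have : (p k < p n)%N by rewrite ltnNge pmono -ltnNge.
    by case: (x n) (y k) => [] []; lia.
  - by case: (x n) (y n) => [] [] //; lia.
have [x [Xx nBx]] : exists x, X x /\ ~ B (d x).
  apply: contrapT => /forallNP XB; apply: nKB; apply: card_le_trans KX _.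
  apply: (@card_le_inj _ _ _ _ d) => [x Xx|x y _ _]; last exact: dinj.
  by apply: contrapT => nBd; apply: (XB x).
exists (d x); split=> // [i oi|n m mh].
  apply/negbTE/negP => /asboolP[n]; rewrite /c => iE; move: oi; rewrite iE.
  by case: (x n); lia.
(* Elements below [m] have index below [n], because [c x k >= p k >= p n > h n >= m] for
   [k >= n]. *)
have dsum i : (i < m)%N -> (d x i <= \sum_(k < n) (i == c x k))%N.
  move=> im; case: (boolP (d x i)) => // /asboolP[k ik].
  have kn : (k < n)%N.
    rewrite ltnNge -pmono; apply/negP => nk.
    by have := ph n; move: im; rewrite ik /c; lia.
  by rewrite (bigD1 (Ordinal kn))//= -ik eqxx.
apply: (@leq_trans (\sum_(i < m) \sum_(k < n) (val i == c x k))).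
  by apply: leq_sum => i _; exact: dsum.
rewrite exchange_big/= -[leqRHS]card_ord -sum1_card; apply: leq_sum => k _.
have [cm|mc] := ltnP (c x k) m.
  rewrite (bigD1 (Ordinal cm))//= eqxx big1 ?addn0// => i ic.
  by apply/eqP; rewrite eqb0; apply: contra ic => /eqP ic; exact/eqP/val_inj.
rewrite big1// => i _; apply/eqP; rewrite eqb0; apply/eqP => ic.
by have := ltn_ord i; rewrite ic ltnNge mc.
Qed.

(** * Consequences of the Menger property *)

Lemma finite_range_bound T (V : nat -> set T) (F : set (set T)) :
  {homo V : m n / (m <= n)%N >-> m `<=` n} -> finite_set F -> F `<=` range V ->
  exists m, forall A, F A -> A `<=` V m.
Proof.
move=> Vmono Ffin FV.
have /choice[k kP] : forall A, exists m, F A -> A = V m.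
  move=> A; have [/FV[m _ <-]|nFA] := pselect (F A); first by exists m.
  by exists 0%N.
have /finite_seqP[s sE] : finite_set (k @` F) by exact: finite_image.
exists (\max_(m <- s) m) => A FA; rewrite {1}(kP A FA).
apply: Vmono; apply: leq_bigmax_seq => //.
have : (k @` F) (k A) by exists A.
by rewrite sE.
Qed.

(** For each [n], the pairs whose [x + y + g] has more than [n] elements below [m] form an open
    cover increasing in [m]. Finite selections thus amount to bounds on [m], which [f] combines. *)
Lemma menger_hitting (X Y : set cantor_space) (g : cantor_space) :
  (forall x y, X x -> Y y -> ~ finite_support (symdiff (symdiff x y) g)) ->
  menger (set_type X * set_type Y)%type ->
  exists f : nat -> nat, forall x y, X x -> Y y -> forall n0,
    exists2 n, (n0 <= n)%N &
      (n < \sum_(i < f n) symdiff (symdiff x y) g i)%N.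
Proof.
move=> inf XYmenger.
pose z (p : set_type X * set_type Y) := symdiff (symdiff (set_val p.1) (set_val p.2)) g.
pose V n m := [set p | (n < \sum_(i < m) z p i)%N].
have Vmono n : {homo V n : a b / (a <= b)%N >-> a `<=` b}.
  move=> a b ab p /leq_trans; apply.
  rewrite (big_ord_widen _ (fun i => nat_of_bool (z p i)) ab) big_mkcond/=.
  by rewrite leq_sum// => i _; case: ifP.
have Vopen n m : open (V n m).
  rewrite openE => p Vp.
  have near1 : \forall q \near p, agree m (set_val p.1) (set_val q.1).
    have : {for p, continuous (fun q : set_type X * set_type Y => set_val q.1)}.
      by apply: continuous_comp; [exact: cvg_fst|exact: initial_continuous].
    by apply; exact: near_agree.
  have near2 : \forall q \near p, agree m (set_val p.2) (set_val q.2).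
    have : {for p, continuous (fun q : set_type X * set_type Y => set_val q.2)}.
      by apply: continuous_comp; [exact: cvg_snd|exact: initial_continuous].
    by apply; exact: near_agree.
  apply: filterS2 near1 near2 => q pq1 pq2.
  rewrite /V/= (eq_bigr (fun i : 'I_m => nat_of_bool (z p i)))// => i _.
  by rewrite /z !symdiffE pq1// pq2.
have Vcover n p : exists m, V n m p.
  have zinf a : exists2 i, (a <= i)%N & z p i.
    apply: contrapT => nz; apply: (inf _ _ (set_valP p.1) (set_valP p.2)).
    by exists a => i ai; apply/negbTE/negP => zi; apply: nz; exists i.
  elim: n => [|n [m mP]].
    by have [i _ zi] := zinf 0%N; exists i.+1; rewrite /V/= big_ord_recr/= zi addn1.
  have [i mi zi] := zinf m; exists i.+1; rewrite /V/= big_ord_recr/= zi addn1 ltnS.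
  exact: Vmono mi _ mP.
(* The Menger property is used once for each [j], on the covers from index [j] on, so that the index
   found for a pair is at least [j]. *)
have /choice[b bP] : forall j, exists b : nat -> nat,
    forall p, exists n, V (j + n)%N (b n) p.
  move=> j; have [n|F [Ffin Fcov]] := XYmenger (fun n => range (V (j + n)%N)).
    split=> [_ [m _ <-]|]; first exact: Vopen.
    apply/seteqP; split=> // p _; have [m mP] := Vcover (j + n)%N p.
    by exists (V (j + n)%N m) => //; exists m.
  have /choice[b bP] : forall n, exists m, forall A, F n A -> A `<=` V (j + n)%N m.
    by move=> n; have [? ?] := Ffin n; apply: finite_range_bound.
  exists b => p; have : [set: set_type X * set_type Y] p by [].
  by rewrite -Fcov => -[n _ [A /bP Ab /Ab]]; exists n.
(* The sum over all [j <= k] makes [f (n0 + n)] at least [b n0 n]. *)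
exists (fun k => \sum_(j < k.+1) b j (k - j))%N => x y Xx Yy n0.
have [n nP] := bP n0 (SigSub (mem_set Xx), SigSub (mem_set Yy)).
exists (n0 + n)%N; first exact: leq_addr.
apply: (Vmono _ _ _ _ _ nP); have n0n : (n0 < (n0 + n).+1)%N by lia.
by rewrite (bigD1 (Ordinal n0n))//= addKn leq_addr.
Qed.


(** Modulo [X] each [y j] equals [d j + g], so a sum of them is congruent to one of the [d j] and
    [g]. *)
Lemma gspan_mod_subgroup (X : set cantor_space) (g : cantor_space)
    (J : Type) (U : set J) (d y : J -> cantor_space) :
  symdiff_subgroup X -> (forall j, U j -> X (symdiff (symdiff (d j) g) (y j))) ->
  forall b, gspan (y @` U) b ->
  exists2 x, X x & gspan ([set g] `|` d @` U) (symdiff x b).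
Proof.
move=> [X0 XD] yX b; elim=> [|_ {}b [j Uj <-] _ [x Xx xb]].
  by exists empty_pt => //; rewrite symdiff0x; exact: gspan0.
exists (symdiff x (symdiff (symdiff (d j) g) (y j))); first by apply: XD => //; exact: yX.
have -> : symdiff (symdiff x (symdiff (symdiff (d j) g) (y j))) (symdiff (y j) b) =
          symdiff (d j) (symdiff g (symdiff x b)).
  apply/funext => i; rewrite !symdiffE.
  by case: (x i) (d j i) (g i) (y j i) (b i) => [] [] [] [] [].
by apply: gspanS; [right; exists j|apply: gspanS => //; left].
Qed.

(* K represents the common value of cov(M) and cof(M); the types [set_type X]
   and [set_type Y] carry the subspace topology. *)
Theorem theorem3p4 (R : realType) (T : Type) (K : set T)
    (hcov : is_covM R K) (hcof : is_cofM R K) (hreg : regular_card K)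
    (X : set cantor_space) (hX : luzin_group K X) :
  exists Y : set cantor_space,
    luzin_group K Y /\ ~ menger (set_type X * set_type Y)%type.
Proof.
have [[F [Fcof FK]] _] := hcof.
have [J [lt [JK ltwf lttrans lttri ltK]]] := initial_well_order K.
have [e eF] := card_eq_range (card_eq_trans FK (card_esym JK)).
have [Nmeager Ncof] := meager_cofinal_cantor Fcof.
have Fe j : F (e j) by rewrite -eF; exists j.
have Mcof (A : set cantor_space) : meager A -> exists j,
    A `<=` [set x | exists2 r, e j r & expands x r].
  by move=> /Ncof[M + AM]; rewrite -eF => -[j _ jM]; exists j; rewrite jM.
have Mmeager j := Nmeager _ (Fe j).
have [h hdom] := meager_cofinal_dominating Mmeager Mcof.
have [[KX XM] Xgrp] := hX.
have nat_lt : card_lt [set: nat] K.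
  by apply: luzin_uncountable (conj KX XM); case: hreg.
pose M j := [set x : cantor_space | exists2 r, e j r & expands x r].
have XM1 (A : set cantor_space) a : meager A -> card_lt (X `&` [set x | A (symdiff a x)]) K.
  by move=> A0; apply: XM; exact: meager_translate.
(* The singletons are included because they span the finite sets. *)
pose E := X `&` [set x : cantor_space |
    exists a, forall i, (a <= i)%N -> odd i -> x i = false]
  `|` range single.
have EK : card_lt E K.
  apply: card_lt_setU => //; first exact/XM/meager_almost_even.
  exact: card_le_lt_trans (card_image_le _ _) nat_lt.
have [g [geven _ gE]] := even_sparse_ex (fun=> 0%N) KX (card_lt_gspan hreg nat_lt EK).
(* [v = (d j, y j)], and [S] is the set of the earlier pairs. *)
pose Q j (S : set (cantor_space * cantor_space)) (v : cantor_space * cantor_space) :=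
  [/\ [/\ even_support v.1, sparse (h j) v.1 & ~ gspan (E `|` ([set g] `|` fst @` S)) v.1],
    X (symdiff (symdiff v.1 g) v.2), ~ gspan (snd @` S) v.2 &
    forall i s, lt i j -> gspan (snd @` S) s -> ~ M i (symdiff s v.2)].
have [j S Sj|u uQ] := @transfinite_choice _ _ lt Q ltwf.
  have SK := card_le_lt_trans Sj (ltK j).
  have imK (f : cantor_space * cantor_space -> cantor_space) : card_lt (f @` S) K.
    exact: card_le_lt_trans (card_image_le _ _) SK.
  have BK : card_lt (gspan (E `|` ([set g] `|` fst @` S))) K.
    apply: card_lt_gspan => //; do 2!apply: card_lt_setU => //.
    by apply: card_lt_finite; [case: hreg|exact: finite_set1].
  have [d [deven dh dB]] := even_sparse_ex (h j) KX BK.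
  pose c := symdiff d g.
  (* Those [x] for which [c + x] lies in the span of the earlier [y], or [s + c + x] falls into an
     earlier [M i]. Each piece is the trace on [X] of a translated meager set. *)
  pose Bad := \bigcup_(s in gspan (snd @` S))
    ((X `&` [set x | [set s] (symdiff c x)]) `|`
     \bigcup_(i in [set i | lt i j]) (X `&` [set x | M i (symdiff (symdiff s c) x)])).
  have [_ nKBad] : card_lt Bad K.
    apply: card_lt_bigcup => // [|s _]; first exact: card_lt_gspan.
    apply: card_lt_setU => //; first by apply: XM1; exact: meager_set1.
    by apply: card_lt_bigcup => // i _; apply: XM1; exact: Mmeager.
  have [x [Xx nBad]] : exists x, X x /\ ~ Bad x.
    apply: contrapT => /forallNP XB; apply: nKBad; apply: card_le_trans KX _.
    by apply: subset_card_le => x Xx; apply: contrapT => nB; apply: (XB x).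
  exists (d, symdiff c x); split=> //=.
  - by rewrite -/c symdiffK.
  - by move=> cS; apply: nBad; exists (symdiff c x) => //; left.
  - move=> i s ij sS; rewrite symdiffA => Mi; apply: nBad; exists s => //.
    by right; exists i.
pose d j := (u j).1; pose y j := (u j).2.
have d_even j : even_support (d j) by have [[]] := uQ j.
have d_sparse j : sparse (h j) (d j) by have [[]] := uQ j.
have d_new j : ~ gspan (E `|` ([set g] `|` d @` [set i | lt i j])) (d j).
  by have [[_ _]] := uQ j; rewrite image_comp.
have yX j : X (symdiff (symdiff (d j) g) (y j)) by have [] := uQ j.
have y_new j : ~ gspan (y @` [set i | lt i j]) (y j).
  by have [_ _] := uQ j; rewrite image_comp.
have y_avoid i j s : lt i j -> gspan (y @` [set i | lt i j]) s ->
    ~ M i (symdiff s (y j)).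
  by have [_ _ _] := uQ j; rewrite image_comp; exact.
exists (gspan (range y)); split; first split; first split.
- rewrite -(card_le_eql JK); apply: (@card_le_inj _ _ _ _ y) => [j _|].
    by apply: gspan_sub; exists j.
  move=> i j _ _ yij; have [ij|//|ji] := lttri i j; exfalso.
    by apply: (y_new j); rewrite -yij; apply: gspan_sub; exists i.
  by apply: (y_new i); rewrite yij; apply: gspan_sub; exists j.
- move=> A A0; have [j AMj] := Mcof _ A0.
  (* An element with top index after [j] avoids [M j], hence [A]; the others lie in the span of
     fewer than [K] generators. *)
  apply: (@card_le_lt_trans _ _ _ _ (gspan (y @` [set k | ~ lt j k]))).
    apply: subset_card_le => b [/(gspan_last ltwf lttrans lttri)].
    move=> [->|[i [s [ss ->]]]] Ab; first exact: gspan0.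
    have [ji|ji] := pselect (lt j i); first by case: (y_avoid _ _ _ ji ss); exact: AMj.
    apply: gspanD; last by apply: gspan_sub; exists i.
    apply: gspan_mono ss; apply: image_subset => k /= ki jk.
    by apply: ji; exact: lttrans ki.
  apply: card_lt_gspan => //; apply: card_le_lt_trans (card_image_le _ _) _.
  apply: (@card_le_lt_trans _ _ _ _ ([set k | lt k j] `|` [set j])).
    apply: subset_card_le => k /= njk.
    by have [jk|<-|kj] := lttri j k; [|right|left].
  apply: card_lt_setU => //.
  by apply: card_lt_finite; [case: hreg|exact: finite_set1].
- exact: gspan_subgroup.
- move=> /(@menger_hitting X _ g)[|f fP]; last first.
    (* With [x = d j + g + y j] and [y = y j] the sum [x + y + g] is [d j], too sparse for [f] as
       soon as [h j] dominates [f]. *)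
    have [j [n0 fh]] := hdom f.
    have [n n0n] := fP _ (y j) (yX j) (gspan_sub (imageP y I)) n0.
    suff -> : symdiff (symdiff (symdiff (symdiff (d j) g) (y j)) (y j)) g = d j.
      by rewrite ltnNge (d_sparse j)// fh.
    apply/funext => i; rewrite !symdiffE.
    by case: (d j i) (g i) (y j i) => [] [] [].
  have EX x v : X x -> even_support v -> finite_support (symdiff x v) -> E x.
    move=> Xx ev [a xv]; left; split=> //; exists a => i ai oi.
    by have := xv _ ai; rewrite symdiffE ev// addbF.
  have Efin z : finite_support z -> gspan E z.
    by move=> /finite_support_gspan; apply: gspan_mono => b; right.
  (* Suppose [x + b + g] is finite. If [b] is zero, then [x] is in [E] and [g] in its span, against
     the choice of [g]. *)
  move=> x b Xx /(gspan_last ltwf lttrans lttri)[->|[i [s [ss ->]]]] zfin.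
    apply: gE; rewrite -(symdiffK x g).
    rewrite symdiffx0 in zfin.
    by apply: gspanS (Efin _ zfin); exact: EX zfin.
  (* Otherwise [b = s + y i] with top index [i]. Reducing modulo [X] turns the sum into
     [x2 + w + d i], where [w] is spanned by [g] and the earlier [d]. As [w + d i] is even, [x2] is
     in [E], which puts [d i] into the span it was chosen to avoid. *)
  have [x1 Xx1 ws] := @gspan_mod_subgroup X g J _ d y Xgrp (fun j _ => yX j) s ss.
  set w := symdiff x1 s in ws.
  have [_ XD] := Xgrp.
  pose x2 := symdiff (symdiff x x1) (symdiff (symdiff (d i) g) (y i)).
  have Xx2 : X x2 by exact: XD (XD _ _ Xx Xx1) (yX i).
  have ew : even_support w.
    apply: gspan_min ws; first exact: even_support_subgroup.
    by move=> _ [->|[k _ <-]] //; exact: d_even.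
  have ewd : even_support (symdiff w (d i)).
    by have [_] := even_support_subgroup; apply=> //; exact: d_even.
  have zE : symdiff (symdiff x (symdiff s (y i))) g = symdiff x2 (symdiff w (d i)).
    apply/funext => k; rewrite /x2 /w !symdiffE.
    by case: (x k) (s k) (y i k) (g k) (x1 k) (d i k) => [] [] [] [] [] [].
  rewrite zE in zfin.
  apply: (d_new i); rewrite -(symdiffK w (d i)).
  apply: gspanD; first by apply: gspan_mono ws => k; right.
  rewrite -(symdiffK x2 (symdiff w (d i))).
  apply: gspanD; first by apply: gspan_sub; left; exact: EX zfin.
  by apply: gspan_mono (Efin _ zfin) => k; left.
Qed.
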